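(* Let $\mathbb{F}_{729}$ be the field with $729$ elements and let $G_{729,28}=\{x\in\mathbb{F}_{729}: x^{28}=1\}$ be the unique subgroup of order $28$ of $\mathbb{F}_{729}^\times$. For $a,b,c\in G_{729,28}$, we have $a+b+c=0$ if and only if $a=b=c$. *)

(* Defs.v *)
From HB Require Import structures.
From mathcomp Require Import all_boot all_order all_fingroup all_algebra.
From mathcomp Require Import all_solvable all_field.
Set Implicit Arguments.
Unset Strict Implicit.
Unset Printing Implicit Defensive.
Import GroupScope GRing.Theory.
Local Open Scope ring_scope.

Definition mu_set (F : finFieldType) (n : nat) : {set F} :=
  [set x : F | x ^+ n == 1].

Lemma card_mu_set (F : finFieldType) (n : nat) :
  (0 < n)%N -> (#|mu_set F n| <= n)%N.
Proof.
move=> n_gt0; rewrite cardE; apply: max_unity_roots => //.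
  by apply/allP=> x; rewrite mem_enum inE => /eqP xn; apply/unity_rootP.
exact: enum_uniq.
Qed.

Lemma mu_set_subgroup (F : finFieldType) (n : nat) (H : {group {unit F}}) :
  (0 < n)%N -> #|H| = n -> [set FinRing.uval u | u in H] = mu_set F n.
Proof.
move=> n_gt0 oH; apply/eqP; rewrite eqEcard; apply/andP; split.
  apply/subsetP=> _ /imsetP[u Hu ->]; rewrite inE -oH.
  by rewrite -FinRing.val_unitX expg_cardG.
by rewrite card_imset ?oH ?card_mu_set //; apply: val_inj.
Qed.

(* [mu_set F 28] is the carrier, inside [F], of the unique subgroup of order
   28 of the multiplicative group of the field with 729 elements. *)
Lemma unique_subgroup_28 (F : finFieldType) : #|F| = 729%N ->
  exists H : {group {unit F}},
    [/\ #|H| = 28%N, [set FinRing.uval u | u in H] = mu_set F 28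
      & forall K : {group {unit F}}, #|K| = 28%N -> K = H].
Proof.
move=> oF; have /cyclicP[x defU] := field_unit_group_cyclic [set: {unit F}]%G.
have ox : #[x]%g = 728%N.
  by rewrite orderE -defU card_finField_unit oF.
have oH : #|<[(x ^+ 26)%g]>| = 28%N by rewrite -orderE orderXdiv ox.
exists <[(x ^+ 26)%g]>%G; split=> [//||K oK]; first exact: mu_set_subgroup.
apply/val_inj/(imset_inj (val_inj : injective (@FinRing.uval F))).
by rewrite /= (mu_set_subgroup _ oK) // (mu_set_subgroup _ oH).
Qed.

(* Main.v *)
(** In characteristic 3, raising to the power [q = 3 ^ n] is additive, and it
    is inversion on the roots of unity of order dividing [q + 1].  If [c = - (a + b)]
    then [1 = (a + b) (a + b) ^ q = (a + b) (1 / a + 1 / b)], that is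
    [a ^ 2 + a b + b ^ 2 = 0]; the left-hand side is [(a - b) ^ 2] in
    characteristic 3.  The theorem is the case [n = 3]. *)
Require Import Defs.
From mathcomp Require Import all_boot all_order all_fingroup all_algebra.
From mathcomp Require Import all_solvable all_field.
From mathcomp Require Import ring.
Import GRing.Theory.
Local Open Scope ring_scope.

Lemma unity_roots_sum3_eq0 (F : fieldType) (n : nat) (a b c : F) :
    3 \in [pchar F] ->
    a ^+ (3 ^ n).+1 = 1 -> b ^+ (3 ^ n).+1 = 1 -> c ^+ (3 ^ n).+1 = 1 ->
  a + b + c = 0 <-> a = b /\ b = c.
Proof.
move=> char3 a1 b1 c1.
have three0 : 3 = 0 :> F by apply: pcharf0.
split=> [abc0 | [<- <-]]; last first.
  by have -> : a + a + a = 3 * a by [ring]; rewrite three0 mul0r.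
have c_def : c = - (a + b) by apply/eqP; rewrite -addr_eq0 addrC abc0.
have frobD : (a + b) ^+ (3 ^ n) = a ^+ (3 ^ n) + b ^+ (3 ^ n).
  by apply: exprDn_pchar; rewrite pnatX pnatE ?char3.
(* The sign [(-1) ^+ (3 ^ n).+1] is 1, since [3 ^ n] is odd. *)
move: c1; rewrite c_def exprNn -signr_odd /= oddX orbT mul1r exprS frobD => c1.
rewrite !exprS in a1 b1.
have sq0 : (a - b) ^+ 2 = 0.
  (* [u] and [v] stand for the inverses of [a] and [b]. Multiplying [(a + b) * (u + v) - 1] by
     [a * b] clears them, up to multiples of [a * u - 1] and [b * v - 1]. *)
  set u := a ^+ (3 ^ n) in a1 c1; set v := b ^+ (3 ^ n) in b1 c1.
  have -> : (a - b) ^+ 2 =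
      a * b * ((a + b) * (u + v) - 1) - 3 * (a * b)
      - (a * b + b ^+ 2) * (a * u - 1) - (a * b + a ^+ 2) * (b * v - 1) by ring.
  by rewrite a1 b1 c1 three0 subrr !(mulr0, mul0r, subr0).
have ab : a = b by apply/eqP; rewrite -subr_eq0 -sqrf_eq0 sq0.
split=> //; rewrite ab.
have -> : - (b + b) = b - 3 * b by ring.
by rewrite three0 mul0r subr0.
Qed.

Theorem theorem1 (F : finFieldType) (cardF : #|F| = 729%N) (a b c : F)
    (aG : a \in mu_set F 28) (bG : b \in mu_set F 28) (cG : c \in mu_set F 28) :
  a + b + c = 0 <-> a = b /\ b = c.
Proof.
have char3 : 3 \in [pchar F] by apply: (@card_finPcharP F 3 6).
move: aG bG cG; rewrite !inE => /eqP aG /eqP bG /eqP cG.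
(* The exponent [28] is [(3 ^ 3).+1] by computation. *)
exact: (@unity_roots_sum3_eq0 F 3).
Qed.
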